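(* Let $\bm{x_0}\in\mathbb{R}^N$ be a monotone signal, i.e. $\bm{x_0}(i+1)\ge \bm{x_0}(i)$ for all $i\in\{1,\ldots,N-1\}$. Let $\Omega=\{i\in\{2,\ldots,N\}:\bm{x_0}(i)>\bm{x_0}(i-1)\}$, assume $\Omega\neq\emptyset$, and let $i_1<i_2<\cdots<i_k$ (with $k\ge 1$) be the elements of $\Omega$ in increasing order. Let $f:\mathbb{R}^N\to\mathbb{R}\cup\{\infty\}$ be given by $f(\bm{x})=\bm{x}(N)-\bm{x}(1)$ if $\bm{x}(i+1)\ge\bm{x}(i)$ for all $i\in\{1,\ldots,N-1\}$, and $f(\bm{x})=\infty$ otherwise. Then the statistical dimension of the descent cone of $f$ at $\bm{x_0}$ equals $$\delta(\mathcal{D}(f,\bm{x_0}))=\sum_{j=2}^{k}H_{i_j-i_{j-1}}+H_{N+i_1-i_k}.$$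
   Context: The descent cone of a convex function $f:\mathbb{R}^N\to\mathbb{R}\cup\{\infty\}$ at a point $\bm{x}\in\mathbb{R}^N$ is $$\mathcal{D}(f,\bm{x})=\bigcup_{\tau>0}\{\bm{y}\in\mathbb{R}^N: f(\bm{x}+\tau\bm{y})\le f(\bm{x})\}.$$ The statistical dimension of a closed convex cone $\mathcal{C}\subseteq\mathbb{R}^N$ is $\delta(\mathcal{C})=\mathbb{E}\,\|\Pi_{\mathcal{C}}(\bm{g})\|^2$, where $\bm{g}\sim\mathcal{N}(\bm{0},I_N)$ is a standard Gaussian vector, $\Pi_{\mathcal{C}}$ is the Euclidean projection onto $\mathcal{C}$ and $\|\cdot\|$ is the Euclidean norm. $H_n=\sum_{i=1}^n\frac1i$ denotes the $n$-th harmonic number. The $i$-th entry of a vector $\bm{x}$ is written $\bm{x}(i)$. *)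

(* Defs.v *)
From HB Require Import structures.
From mathcomp Require Import all_boot all_order all_algebra.
From mathcomp Require Import all_classical all_reals all_analysis.

Set Implicit Arguments.
Unset Strict Implicit.
Unset Printing Implicit Defensive.

Import Order.TTheory GRing.Theory Num.Theory.

Local Open Scope classical_set_scope.
Local Open Scope ring_scope.

(* MathComp-Analysis norms matrices by the sup norm, so `|x| is not the
   Euclidean norm on 'rV[R]_n. *)
Definition eucl_norm (R : realType) (n : nat) (x : 'rV[R]_n) : R :=
  Num.sqrt (\sum_i x 0 i ^+ 2).

(* The nearest point of C to x; it exists and is unique when C is nonempty,
   closed and convex, and the value is 0 when there is no nearest point. *)
Definition eucl_proj (R : realType) (n : nat) (C : set 'rV[R]_n) (x : 'rV[R]_n)
    : 'rV[R]_n :=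
  xget 0 [set p | C p /\ forall q, C q -> eucl_norm (x - p) <= eucl_norm (x - q)].

Section standard_gaussian.
Variable R : realType.

Definition tuple_cons (n : nat) (p : measurableTypeR R * n.-tuple R) : n.+1.-tuple R :=
  [tuple of p.1 :: p.2].

Lemma measurable_tuple_cons (n : nat) : measurable_fun setT (@tuple_cons n).
Proof. by apply: measurable_cons. Qed.

HB.instance Definition _ (n : nat) :=
  isMeasurableFun.Build _ _ _ _ (@tuple_cons n) (@measurable_tuple_cons n).

(* N(0, I_n): the n-fold product of N(0, 1), see std_gaussian_box. *)
Fixpoint std_gaussian (n : nat) : probability (n.-tuple R) R :=
  match n return probability (n.-tuple R) R with
  | 0 => \d_([tuple])
  | n'.+1 => distribution (normal_prob (0 : R) 1 \x std_gaussian n')%E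
               (@tuple_cons n')
  end.

Lemma std_gaussian_box (n : nat) (B : 'I_n -> set R) :
  (forall i, measurable (B i)) ->
  std_gaussian n [set t | forall i, B i (tnth t i)] =
  (\prod_(i < n) normal_prob (0 : R) 1 (B i))%E.
Proof.
elim: n B => [|n IHn] B mB /=.
  by rewrite big_ord0 diracE mem_set //= => -[].
rewrite big_ord_recl -IHn // -product_measure1E //; first last.
- rewrite [X in measurable X](_ : _ = \bigcap_(i in [set: 'I_n])
      ((fun t : n.-tuple R => tnth t i) @^-1` B (lift ord0 i))); last first.
    by apply/seteqP; split => t /= h i => [_|]; exact: h.
  apply: fin_bigcap_measurable => // i _; rewrite -[X in measurable X]setTI.
  exact: measurable_tnth.
- exact: mB.
have tS (x : R) (t : n.-tuple R) j :
    tnth (tuple_cons (x, t)) (lift ord0 j) = tnth t j by exact: tnthS.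
rewrite /distribution /pushforward.
set A := (X in _ X = _); set A' := (X in _ = _ X).
suff -> : A = A' by [].
apply/seteqP; split => [[x t] h|[x t] [h0 h] i].
  by split=> [|i]; [exact: (h ord0) | rewrite -(tS x); exact: h].
by case: (unliftP ord0 i) => [j ->|->]; [rewrite tS; exact: h | exact: h0].
Qed.

End standard_gaussian.

Definition row_of_tuple (R : realType) (n : nat) (t : n.-tuple R) : 'rV[R]_n :=
  \row_i tnth t i.

Definition stat_dim (R : realType) (n : nat) (C : set 'rV[R]_n) : \bar R :=
  ('E_(std_gaussian R n)[
     (fun g => eucl_norm (eucl_proj C (row_of_tuple g)) ^+ 2)%R])%E.

Definition descent_cone (R : realType) (n : nat) (f : 'rV[R]_n -> \bar R)
    (x : 'rV[R]_n) : set 'rV[R]_n :=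
  \bigcup_(tau in [set t : R | 0 < t]) [set y | (f (x + tau *: y)%R <= f x)%E].

Definition monotone_signal (R : realType) (n : nat) (x : 'rV[R]_n) : bool :=
  [forall i : 'I_n, forall j : 'I_n, (j == i.+1 :> nat) ==> (x 0 i <= x 0 j)].

Definition jumps (R : realType) (n : nat) (x : 'rV[R]_n) : {set 'I_n} :=
  [set i : 'I_n | [exists j : 'I_n, (i == j.+1 :> nat) && (x 0 j < x 0 i)]].

(* The ambient dimension is n.+1, so that the first and last entries exist. *)
Definition monotone_variation (R : realType) (n : nat) (x : 'rV[R]_n.+1)
    : \bar R :=
  if monotone_signal x then (x 0 ord_max - x 0 ord0)%:E else +oo%E.

Definition harmonic_number (R : realType) (n : nat) : R :=
  \sum_(1 <= i < n.+1) i%:R^-1.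

(* Main.v *)
Require Import Defs.
From HB Require Import structures.
From mathcomp Require Import all_boot all_order all_algebra.
From mathcomp Require Import all_classical all_reals all_analysis.
From mathcomp Require Import measurable_realfun.
From mathcomp Require Import ring lra zify.

(** The descent cone at a monotone signal consists of the vectors that are
    nondecreasing along each block of indices between two consecutive jumps,
    where the last block continues cyclically through the first entries, because
    the total variation must not increase
    (descent_cone_monotone_variation).  After a rotation it is a product of
    cones of nondecreasing vectors, of dimensions i_j - i_(j-1) and
    N + i_1 - i_k.  Statistical dimension is additive over products, so it
    remains to see that the cone of nondecreasing vectors of R^d has statistical
    dimension 1 + 1/2 + ... + 1/d.

    For a closed cone C, the squared norm of the projection of x is the supremum
    of 2 <x, q> - |q|^2 over q in C (sqr_eucl_norm_proj).  Let Q_d(x) be this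
    supremum for the nondecreasing cone.  The heart of the proof is a
    deterministic identity (sum_proj_sqnorm_rotate), a cousin of the
    combinatorial lemmas of Kac and Spitzer on maxima of random walks: summed
    over the d + 1 cyclic rotations y of a vector x,

      sum_y Q_(d+1)(y) = sum_y Q_d(y without its last entry) + S^2 / (d + 1),

    where S is the sum of the entries of x.  By translation one may assume
    S = 0.  The supremum splits into one over nonnegative and one over
    nonpositive nondecreasing q (proj_sqnorm_sign).  As S = 0, lowering a
    nonnegative q by its first entry changes no inner product and shortens q, so
    the first of these suprema ignores the first entry of y; likewise the second
    one ignores the last entry.  Dropping the first entry of a rotation is
    dropping the last entry of the next one, and the two halves recombine.

    Under the Gaussian law all rotations have the same distribution and S^2 has
    mean d + 1, so the identity says that the statistical dimension grows by
    1 / (d + 1) from d to d + 1 (integral_proj_sqnorm_nondecr).  Only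
    nonnegative functions are ever integrated. *)

Set Implicit Arguments.
Unset Strict Implicit.
Unset Printing Implicit Defensive.

Import Order.TTheory GRing.Theory Num.Theory.
Import numFieldNormedType.Exports.

Local Open Scope classical_set_scope.
Local Open Scope ring_scope.

(** * The squared norm of a projection as a supremum *)

Section gain.
Variable R : realType.
Implicit Types (d : nat) (x q : nat -> R) (C : set (nat -> R)).

(** This is |x|^2 - |x - q|^2 in the first d coordinates, so that the point of a
    cone nearest to x is the one of largest gain.  Vectors are functions on nat
    because prefixes, shifts and cyclic rotations are then plain compositions
    that need no casts between dimensions. *)
Definition gain d x q : R := \sum_(i < d) (2 * x i * q i - q i ^+ 2).

(** For a closed cone C the projection p of x satisfies <x, p> = |p|^2, hence
    the largest gain is |p|^2: see sqr_eucl_norm_proj.  Working with the supremum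
    removes the projection itself from the whole computation. *)
Definition proj_sqnorm C d x : R := sup [set gain d x q | q in C].

Lemma gain_le_sqnorm d x q : gain d x q <= \sum_(i < d) x i ^+ 2.
Proof.
apply: ler_sum => i _; have := sqr_ge0 (x i - q i); nra.
Qed.

Lemma proj_sqnorm_ub C d x q : C q -> gain d x q <= proj_sqnorm C d x.
Proof.
move=> Cq; apply: ub_le_sup; last by exists q.
by exists (\sum_(i < d) x i ^+ 2) => _ [p _ <-]; exact: gain_le_sqnorm.
Qed.

Lemma proj_sqnorm_le C d x v : C !=set0 ->
  (forall q, C q -> gain d x q <= v) -> proj_sqnorm C d x <= v.
Proof.
move=> [q0 Cq0] h; apply: ge_sup; first by exists (gain d x q0), q0.
by move=> _ [p Cp <-]; exact: h.
Qed.

Lemma gain0 d x : gain d x (fun=> 0) = 0.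
Proof. by rewrite /gain big1// => i _; rewrite mulr0 expr0n subr0. Qed.

Lemma proj_sqnorm_ge0 C d x : C (fun=> 0) -> 0 <= proj_sqnorm C d x.
Proof. by move=> C0; rewrite -(gain0 d x); exact: proj_sqnorm_ub. Qed.

Lemma eq_gain d x x' q q' : (forall i, (i < d)%N -> x i = x' i) ->
  (forall i, (i < d)%N -> q i = q' i) -> gain d x q = gain d x' q'.
Proof. by move=> xx' qq'; apply: eq_bigr => i _; rewrite xx'// qq'. Qed.

Lemma eq_proj_sqnorm C d x x' : (forall i, (i < d)%N -> x i = x' i) ->
  proj_sqnorm C d x = proj_sqnorm C d x'.
Proof.
move=> xx'; congr sup; apply/seteqP.
by split=> _ [q Cq <-]; exists q => //; apply: eq_gain => // i /xx'.
Qed.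

(** * Monotone cones *)

Definition nondecr d : set (nat -> R) :=
  [set q | forall i j, (i <= j)%N -> (j < d)%N -> q i <= q j].
Definition nondecr_ge0 d : set (nat -> R) :=
  [set q | nondecr d q /\ forall i, (i < d)%N -> 0 <= q i].
Definition nondecr_le0 d : set (nat -> R) :=
  [set q | nondecr d q /\ forall i, (i < d)%N -> q i <= 0].

Lemma nondecr0 d : nondecr d (fun=> 0).
Proof. by move=> i j _ _; exact: lexx. Qed.

Lemma nondecr_ge00 d : nondecr_ge0 d (fun=> 0).
Proof. by split; [exact: nondecr0 | move=> i _; exact: lexx]. Qed.

Lemma nondecr_le00 d : nondecr_le0 d (fun=> 0).
Proof. by split; [exact: nondecr0 | move=> i _; exact: lexx]. Qed.


Local Notation Q d := (proj_sqnorm (nondecr d) d).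
Local Notation Qp d := (proj_sqnorm (nondecr_ge0 d) d).
Local Notation Qn d := (proj_sqnorm (nondecr_le0 d) d).

(** The way every lower bound below by a sum of two suprema is obtained. *)
Lemma proj_sqnorm_add C C1 C2 d d1 d2 x x1 x2 :
  C1 !=set0 -> C2 !=set0 ->
  (forall q1 q2, C1 q1 -> C2 q2 -> 
    exists2 q, C q & gain d1 x1 q1 + gain d2 x2 q2 <= gain d x q) ->
  proj_sqnorm C1 d1 x1 + proj_sqnorm C2 d2 x2 <= proj_sqnorm C d x.
Proof.
move=> C10 C20 h; rewrite -lerBrDr; apply: proj_sqnorm_le => // q1 Cq1.
rewrite lerBrDr -lerBrDl; apply: proj_sqnorm_le => // q2 Cq2.
rewrite lerBrDl; have [q Cq /le_trans] := h _ _ Cq1 Cq2.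
by apply; exact: proj_sqnorm_ub.
Qed.

(** A monotone q is the sum of its positive part and its negative part, which
    are monotone and orthogonal; conversely the sum of a nonnegative and a
    nonpositive monotone vector is monotone, and the inner product of the two
    summands is at most 0, which only increases the gain. *)
Lemma proj_sqnorm_sign d x : Q d x = Qp d x + Qn d x.
Proof.
apply/eqP; rewrite eq_le; apply/andP; split.
  apply: proj_sqnorm_le => [|q qmon]; first by exists (fun=> 0); exact: nondecr0.
  pose p i := Num.max (q i) 0; pose n i := Num.min (q i) 0.
  have -> : gain d x q = gain d x p + gain d x n.
    rewrite -big_split/=; apply: eq_bigr => i _; rewrite /p /n.
    by have [] := leP (q i) 0 => ?; ring.
  apply: lerD; apply: proj_sqnorm_ub; split=> i.
  - by move=> j ij jd; rewrite /p ge_max !le_max (qmon i j)// lexx orbT.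
  - by rewrite /p le_max lexx orbT.
  - by move=> j ij jd; rewrite /n le_min !ge_min (qmon i j)// lexx orbT.
  - by rewrite /n ge_min lexx orbT.
apply: proj_sqnorm_add => [||q1 q2 [m1 p1] [m2 n2]].
- by exists (fun=> 0); exact: nondecr_ge00.
- by exists (fun=> 0); exact: nondecr_le00.
exists (fun i => q1 i + q2 i); first by move=> i j ij jd; rewrite lerD ?m1 ?m2.
rewrite -big_split/=; apply: ler_sum => i _.
have := p1 i (ltn_ord i); have := n2 i (ltn_ord i); nra.
Qed.

(** The monotone cone is invariant under adding constants; one inequality gives
    the other by shifting back by - m. *)
Lemma proj_sqnorm_shift d x m :
  Q d (fun i => x i + m) = Q d x + 2 * m * (\sum_(i < d) x i) + d%:R * m ^+ 2.
Proof.
suff le y k : Q d (fun i => y i + k) <=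
    Q d y + 2 * k * (\sum_(i < d) y i) + d%:R * k ^+ 2.
  apply/eqP; rewrite eq_le le/=.
  have := le (fun i => x i + m) (- m).
  under eq_proj_sqnorm do rewrite addrK.
  rewrite big_split/= sumr_const card_ord -mulr_natl; lra.
apply: proj_sqnorm_le => [|q qmon]; first by exists (fun=> 0); exact: nondecr0.
have : gain d y (fun i => q i - k) <= Q d y.
  by apply: proj_sqnorm_ub => i j ij jd; rewrite lerD2r qmon.
suff -> : gain d (fun i => y i + k) q = gain d y (fun i => q i - k) +
    2 * k * (\sum_(i < d) y i) + d%:R * k ^+ 2 by lra.
rewrite [d%:R * _]mulr_natl mulr_sumr -[in k ^+ 2 *+ d](card_ord d) -sumr_const.
by rewrite -!big_split/=; apply: eq_bigr => i _; ring.
Qed.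

(** When the entries of x have a nonpositive sum, subtracting the first (least)
    entry of q from all entries of q does not decrease the gain; so one may
    take q 0 = 0, and the first entry of x no longer matters. *)
Lemma proj_sqnorm_ge0_behead d x : \sum_(i < d.+1) x i <= 0 ->
  Qp d.+1 x = Qp d (x \o succn).
Proof.
move=> x0; apply/eqP; rewrite eq_le; apply/andP; split.
  apply: proj_sqnorm_le => [|q [qmon q0]]; first by exists (fun=> 0); exact: nondecr_ge00.
  pose p i := q i.+1 - q 0.
  apply: (@le_trans _ _ (gain d (x \o succn) p)); last first.
    apply: proj_sqnorm_ub; split=> [i j ij jd|i id].
      by rewrite lerD2r qmon.
    by rewrite subr_ge0 qmon.
  suff : gain d.+1 x q - 2 * q 0%N * (\sum_(i < d.+1) x i) <= gain d (x \o succn) p.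
    have := q0 0%N isT; nra.
  rewrite mulr_sumr -sumrB big_ord_recl/= -[leRHS]add0r; apply: lerD.
    have := sqr_ge0 (q 0%N); lra.
  apply: ler_sum => i _; rewrite /p /bump/= add1n.
  have := q0 0%N isT; have := qmon 0%N i.+1 isT (ltn_ord i); nra.
apply: proj_sqnorm_le => [|q [qmon q0]]; first by exists (fun=> 0); exact: nondecr_ge00.
pose p i := if i is j.+1 then q j else 0.
suff -> : gain d (x \o succn) q = gain d.+1 x p.
  apply: proj_sqnorm_ub; split=> [[|i] [|j]//= ij jd|[|i] id//=].
  - exact: q0.
  - exact: qmon.
  - exact: q0.
by rewrite [RHS]big_ord_recl/= mulr0 expr0n subr0 add0r.
Qed.

(** The mirror image: the last (largest) entry of q may be taken to be 0. *)
Lemma proj_sqnorm_le0_belast d x : 0 <= \sum_(i < d.+1) x i ->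
  Qn d.+1 x = Qn d x.
Proof.
move=> x0; apply/eqP; rewrite eq_le; apply/andP; split.
  apply: proj_sqnorm_le => [|q [qmon q0]]; first by exists (fun=> 0); exact: nondecr_le00.
  pose p i := q i - q d.
  apply: (@le_trans _ _ (gain d x p)); last first.
    apply: proj_sqnorm_ub; split=> [i j ij jd|i id].
      by rewrite lerD2r qmon// ltnW.
    by rewrite subr_le0 qmon// ltnW.
  suff : gain d.+1 x q - 2 * q d * (\sum_(i < d.+1) x i) <= gain d x p.
    have := q0 d (ltnSn d); nra.
  rewrite mulr_sumr -sumrB big_ord_recr/= -[leRHS]addr0; apply: lerD; last first.
    have := sqr_ge0 (q d); lra.
  apply: ler_sum => i _; rewrite /p.
  have := q0 d (ltnSn d); have := qmon i d (ltnW (ltn_ord i)) (ltnSn d); nra.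
apply: proj_sqnorm_le => [|q [qmon q0]]; first by exists (fun=> 0); exact: nondecr_le00.
pose p i := if (i < d)%N then q i else 0.
suff -> : gain d x q = gain d.+1 x p.
  apply: proj_sqnorm_ub; split=> [i j ij jd|i id]; rewrite /p.
    case: ltnP => id; case: ltnP => jd'//; first exact: qmon.
      exact: q0.
    lia.
  by case: ltnP => // id'; exact: q0.
have pd : p d = 0 by rewrite /p ltnn.
rewrite [RHS]big_ord_recr/= pd mulr0 expr0n subr0 addr0.
by apply: eq_gain => // i id; rewrite /p id.
Qed.

(** * The cyclic identity *)

Definition rotate n r x : nat -> R := fun i => x ((i + r) %% n)%N.

Lemma sum_rotate n r (F : nat -> R) :
  \sum_(i < n) F ((i + r) %% n)%N = \sum_(i < n) F i.
Proof.
case: n => [|n]; first by rewrite !big_ord0.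
rewrite [RHS](reindex_inj (@addIr _ (inord (r %% n.+1) : 'I_n.+1))).
apply: eq_bigr => i _ /=; rewrite inordK ?ltn_mod//; congr F.
by rewrite modnDmr.
Qed.

(** When the sum is 0, both reductions above apply: the nonnegative part only
    sees x without its first entry, the nonpositive part only sees x without its
    last entry.  A rotation without its first entry is the next rotation without
    its last entry, so after summation over all rotations the two parts
    recombine into a projection in dimension d. *)
Lemma sum_proj_sqnorm_rotate_centred d x : \sum_(i < d.+1) x i = 0 ->
  \sum_(r < d.+1) Q d.+1 (rotate d.+1 r x) = \sum_(r < d.+1) Q d (rotate d.+1 r x).
Proof.
move=> x0.
transitivity (\sum_(r < d.+1) (Qp d (rotate d.+1 r.+1 x) + Qn d (rotate d.+1 r x))).
  apply: eq_bigr => r _; have s0 : \sum_(i < d.+1) rotate d.+1 r x i = 0.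
    by rewrite sum_rotate.
  rewrite proj_sqnorm_sign proj_sqnorm_ge0_behead ?s0//.
  rewrite proj_sqnorm_le0_belast ?s0//; congr (_ + _).
  by apply: eq_proj_sqnorm => i id; rewrite /rotate/= addSnnS.
under [RHS]eq_bigr do rewrite proj_sqnorm_sign.
rewrite !big_split/=; congr (_ + _).
rewrite -(sum_rotate _ 1 (fun r => Qp d (rotate d.+1 r x))).
apply: eq_bigr => r _; apply: eq_proj_sqnorm => i id; rewrite /rotate.
by rewrite modnDmr addn1.
Qed.

(** Reduction to the centred case by subtracting the mean m.  All the terms in
    m collect into (d+1) m^2, which is the last summand. *)
Lemma sum_proj_sqnorm_rotate d x :
  \sum_(r < d.+1) Q d.+1 (rotate d.+1 r x) =
  \sum_(r < d.+1) Q d (rotate d.+1 r x) + (\sum_(i < d.+1) x i) ^+ 2 / d.+1%:R.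
Proof.
set s := \sum_(i < d.+1) x i; pose m := s / d.+1%:R; pose y i := x i - m.
have d0 : d.+1%:R != 0 :> R by rewrite pnatr_eq0.
have mE : m * d.+1%:R = s by rewrite /m divfK.
have y0 : \sum_(i < d.+1) y i = 0.
  by rewrite sumrB sumr_const card_ord -mulr_natr mE subrr.
have xE r n : Q n (rotate d.+1 r x) = Q n (fun i => rotate d.+1 r y i + m).
  by apply: eq_proj_sqnorm => i _; rewrite /rotate/y subrK.
have sumy : \sum_(r < d.+1) 2 * m * \sum_(i < d) rotate d.+1 r y i = 0.
  rewrite -mulr_sumr exchange_big/= big1 ?mulr0// => i _; under eq_bigr do rewrite /rotate addnC.
  by rewrite sum_rotate.
under eq_bigr do rewrite xE proj_sqnorm_shift sum_rotate y0 mulr0 addr0.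
under [in RHS]eq_bigr do rewrite xE proj_sqnorm_shift.
rewrite !big_split/= sum_proj_sqnorm_rotate_centred// sumy addr0.
rewrite -addrA; congr (_ + _); rewrite !sumr_const card_ord -[LHS]mulr_natr -[X in X + _]mulr_natr.
rewrite -mE; move: d0; rewrite -natr1; move: (d%:R : R) => c c0.
by field.
Qed.

End gain.

(** * The second moment of the normal law *)

Section normal.
Variable R : realType.
Local Notation phi := (normal_pdf (0 : R) 1).
Local Notation mu := (@lebesgue_measure R).
Local Notation N01 := (normal_prob (0 : R) 1).

Lemma std_pdfE (x : R) : phi x = normal_peak 1 * expR (- x ^+ 2 / 2).
Proof. by rewrite normal_pdfE ?oner_neq0// /normal_fun subr0 expr1n. Qed.

Lemma std_pdfN (x : R) : phi (- x) = phi x.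
Proof. by rewrite !std_pdfE sqrrN. Qed.

Lemma continuous_std_pdf : continuous phi.
Proof. by apply: continuous_normal_pdf; exact: oner_neq0. Qed.

Lemma measurable_std_pdf : measurable_fun setT phi.
Proof. exact: measurable_normal_pdf. Qed.

(** Up to sign, x phi(x) is an antiderivative of (x^2 - 1) phi(x): this is what
    makes the second moment equal to the total mass. *)
Lemma is_derive_id_std_pdf (x : R) : is_derive x 1 (fun y => y * phi y) ((1 - x ^+ 2) * phi x).
Proof.
rewrite (_ : (fun y => _) = fun y : R => normal_peak 1 * (y * expR (- y ^+ 2 / 2))); last first.
  by apply/funext => y; rewrite std_pdfE; ring.
apply: is_derive_eq.
rewrite std_pdfE /GRing.scale/=; by field.
Qed.

Lemma cvg_id_std_pdf : x * phi x @[x --> +oo] --> (0 : R).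
Proof.
have c0 : 0 <= normal_peak (1 : R) by exact: normal_peak_ge0.
apply: (@squeeze_cvgr _ _ _ _ (fun=> 0) (fun x => normal_peak 1 * 2 * x^-1)).
- near=> x; have x0 : 0 < x by near: x; exact: nbhs_pinfty_gt.
  rewrite mulr_ge0 ?(ltW x0) ?normal_pdf_ge0//= std_pdfE mulNr expRN.
  rewrite mulrCA -mulrA ler_wpM2l// ler_pdivrMr ?expR_gt0//.
  have := expR_ge1Dx (x ^+ 2 / 2); set e := expR _ => he.
  rewrite mulrAC ler_pdivlMr//; nra.
- exact: cvg_cst.
- rewrite -[X in _ --> X](mulr0 (normal_peak 1 * 2)); apply: cvgMr.
  apply/gtr0_cvgV0 => //.
  by near=> x; near: x; exact: nbhs_pinfty_gt.
Unshelve. all: by end_near. Qed.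

Lemma derivable_id_std_pdf (x : R) : derivable (fun y : R => y * phi y) x 1.
Proof. by have [] := is_derive_id_std_pdf x. Qed.

Lemma continuous_id_std_pdf : continuous (fun y : R => y * phi y).
Proof.
by move=> x; apply/differentiable_continuous/derivable1_diffP/derivable_id_std_pdf.
Qed.

Lemma continuous_sqr_std_pdf : continuous (fun y : R => y ^+ 2 * phi y).
Proof.
move=> x; apply: cvgM; last exact: continuous_std_pdf.
exact: exprn_continuous.
Qed.

(** The integrand (x^2 - 1) phi(x) changes sign at 1; it is integrated with a
    constant sign on either side, and the two integrals cancel. *)
Lemma integral_std_pdf_sqrB1_1y :
  (\int[mu]_(x in `[1%R, +oo[) ((x ^+ 2 - 1) * phi x)%:E = (phi 1)%:E)%E.
Proof.
rewrite (@ge0_continuous_FTC2y R _ (fun x => - (x * phi x)) 1 0).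
- by rewrite mul1r EFinN sub0e oppeK.
- by move=> x x1; rewrite mulr_ge0 ?normal_pdf_ge0// subr_ge0 exprn_ege1.
- apply: continuous_subspaceT => x; under eq_fun do rewrite mulrBl mul1r.
  by apply: cvgB; [exact: continuous_sqr_std_pdf | exact: continuous_std_pdf].
- by rewrite -[X in _ --> X]oppr0; apply: cvgN; exact: cvg_id_std_pdf.
- by move=> x _; apply: derivableN; exact: derivable_id_std_pdf.
- apply: cvg_at_right_filter; apply: cvgN; exact: continuous_id_std_pdf.
- move=> x _; rewrite derive1E deriveN; last exact: derivable_id_std_pdf.
  by have [_ ->] := is_derive_id_std_pdf x; ring.
Qed.

Lemma integral_std_pdf_1Bsqr_01 :
  (\int[mu]_(x in `[0%R, 1%R]) ((1 - x ^+ 2) * phi x)%:E = (phi 1)%:E)%E.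
Proof.
rewrite (@continuous_FTC2 R _ (fun x => x * phi x) 0 1) => //.
- by rewrite mul1r mul0r sube0.
- apply: continuous_subspaceT => x; under eq_fun do rewrite mulrBl mul1r.
  by apply: cvgB; [exact: continuous_std_pdf | exact: continuous_sqr_std_pdf].
- split; first by move=> x _; exact: derivable_id_std_pdf.
    by apply: cvg_at_right_filter; exact: continuous_id_std_pdf.
  by apply: cvg_at_left_filter; exact: continuous_id_std_pdf.
- by move=> x _; rewrite derive1E; have [_ ->] := is_derive_id_std_pdf x.
Qed.

Lemma integral_sqr_std_pdf_0y :
  (\int[mu]_(x in `[0%R, +oo[) (x ^+ 2 * phi x)%:E =
   \int[mu]_(x in `[0%R, +oo[) (phi x)%:E)%E.
Proof.
have split_int (f : R -> R) : continuous f -> (forall x, 0 <= f x) ->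
    (\int[mu]_(x in `[0%R, +oo[) (f x)%:E = \int[mu]_(x in `[0%R, 1%R]) (f x)%:E
      + \int[mu]_(x in `[1%R, +oo[) (f x)%:E)%E.
  move=> cf f0; have mf : measurable_fun [set: R] f by exact: continuous_measurable_fun.
  rewrite -(@integral_itv_obnd_cbnd R 1%R); last exact/measurable_EFinP/measurable_funTS.
  rewrite -ge0_integral_setU//=.
  - by rewrite -itv_bndbnd_setU ?bnd_simp.
  - exact/measurable_EFinP/measurable_funTS.
  - by move=> x _; rewrite lee_fin.
  - apply/disj_setPS => x /= []; rewrite !in_itv/= andbT => /andP[_ x1] x1'.
    by have := le_lt_trans x1 x1'; rewrite ltxx.
have D (f g : R -> R) (A : set R) : measurable A -> continuous f -> continuous g ->
    (forall x, A x -> 0 <= f x) -> (forall x, A x -> 0 <= g x) ->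
    (\int[mu]_(x in A) (f x + g x)%:E = \int[mu]_(x in A) (f x)%:E +
      \int[mu]_(x in A) (g x)%:E)%E.
  move=> mA cf cg f0 g0.
  have mf : measurable_fun [set: R] f by exact: continuous_measurable_fun.
  have mg : measurable_fun [set: R] g by exact: continuous_measurable_fun.
  under eq_integral do rewrite EFinD.
  rewrite ge0_integralD//=.
  - exact/measurable_EFinP/measurable_funTS.
  - exact/measurable_EFinP/measurable_funTS.
have cp := continuous_std_pdf; have cs := continuous_sqr_std_pdf.
rewrite !split_int//; last first.
- by move=> x; rewrite mulr_ge0 ?sqr_ge0 ?normal_pdf_ge0.
- by move=> x; exact: normal_pdf_ge0.
have -> : (\int[mu]_(x in `[1%R, +oo[) (x ^+ 2 * phi x)%:E =
    \int[mu]_(x in `[1%R, +oo[) (phi x)%:E + (phi 1)%:E)%E.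
  rewrite -integral_std_pdf_sqrB1_1y -D//.
  - by apply: eq_integral => x _; congr EFin; ring.
  - move=> x; under eq_fun do rewrite mulrBl mul1r.
    by apply: cvgB; [exact: cs | exact: cp].
  - by move=> x _; exact: normal_pdf_ge0.
  - move=> x /=; rewrite in_itv/= andbT => x1.
    by rewrite mulr_ge0 ?normal_pdf_ge0// subr_ge0 exprn_ege1.
rewrite addeCA addeC; congr (_ + _)%E.
rewrite -integral_std_pdf_1Bsqr_01 -D//.
- by apply: eq_integral => x _; congr EFin; ring.
- move=> x; under eq_fun do rewrite mulrBl mul1r.
  by apply: cvgB; [exact: cp | exact: cs].
- by move=> x _; rewrite mulr_ge0 ?sqr_ge0 ?normal_pdf_ge0.
- move=> x /=; rewrite in_itv/= => /andP[x0 x1].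
  by rewrite mulr_ge0 ?normal_pdf_ge0// subr_ge0 exprn_ile1.
Qed.

(** A Radon-Nikodym derivative is determined almost everywhere by its
    integrals, so it may be replaced by the explicit density. *)
Lemma ge0_integral_std_normal (f : measurableTypeR R -> \bar R) : measurable_fun setT f ->
  (forall x, 0 <= f x)%E -> (\int[N01]_x f x = \int[mu]_x (f x * (phi x)%:E))%E.
Proof.
move=> mf f0.
have dom := normal_prob_dominates (0 : R) 1.
rewrite -(Radon_Nikodym_SigmaFinite.change_of_variables dom)//.
have fi := Radon_Nikodym_SigmaFinite.f_integrable dom.
apply: ae_eq_integral => //.
- by apply: emeasurable_funM => //; exact: measurable_int fi.
- by apply: emeasurable_funM => //; apply/measurable_EFinP; exact: measurable_std_pdf.
have : ae_eq mu setT (Radon_Nikodym_SigmaFinite.f N01 mu) (EFin \o phi).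
  apply: integral_ae_eq => //; first by apply/measurable_EFinP; exact: measurable_std_pdf.
  by move=> E _ mE; rewrite -Radon_Nikodym_SigmaFinite.f_integral.
by apply: filterS => x /[apply] ->.
Qed.

Lemma integral_sqr_std_normal : (\int[N01]_x (x ^+ 2)%:E = 1)%E.
Proof.
rewrite ge0_integral_std_normal; last first.
- by move=> x; rewrite lee_fin sqr_ge0.
- by apply/measurable_EFinP; exact: measurable_funX.
transitivity (\int[mu]_x (phi x)%:E)%E; last exact: integral_normal_pdf.
under eq_integral do rewrite -EFinM.
have h1 := @ge0_symfun_integralT R phi (normal_pdf_ge0 _ _) continuous_std_pdf
  (fun x => esym (std_pdfN x)).
have h2 := @ge0_symfun_integralT R (fun x => x ^+ 2 * phi x)
  (fun x => mulr_ge0 (sqr_ge0 x) (normal_pdf_ge0 _ _ x)) continuous_sqr_std_pdf.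
rewrite h1 h2; last by move=> x /=; rewrite std_pdfN sqrrN.
congr (_ * _)%E; rewrite -set_itvcy; exact: integral_sqr_std_pdf_0y.
Qed.

Lemma ge0_integral_std_normalN (f : measurableTypeR R -> \bar R) :
  measurable_fun setT f -> (forall x, 0 <= f x)%E ->
  (\int[N01]_x f (- x)%R = \int[N01]_x f x)%E.
Proof.
move=> mf f0.
have mopp : measurable_fun [set: measurableTypeR R] (-%R : _ -> measurableTypeR R).
  exact: oppr_measurable.
rewrite !ge0_integral_std_normal//; last first.
  exact: measurableT_comp.
pose g (x : measurableTypeR R) := (f x * (phi x)%:E)%E.
have mg : measurable_fun setT g.
  by apply: emeasurable_funM => //; apply/measurable_EFinP; exact: measurable_std_pdf.
have g0 x : (0 <= g x)%E by rewrite mule_ge0// lee_fin normal_pdf_ge0.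
transitivity (\int[pushforward mu (-%R : _ -> measurableTypeR R)]_x g x)%E.
  rewrite (ge0_integral_pushforward mopp mu measurableT mg); last by move=> x _.
  by rewrite preimage_setT; apply: eq_integral => x _; rewrite /g /comp std_pdfN.
by apply: eq_measure_integral => A mA _; exact: lebesgue_measureN.
Qed.

(** The parallelogram law and the symmetry of the normal law give this without
    the first moment, so that only nonnegative functions are integrated. *)
Lemma integral_sqr_std_normalD (s : R) :
  (\int[N01]_x ((x + s) ^+ 2)%:E = (1 + s ^+ 2)%:E)%E.
Proof.
have mS (t : R) : measurable_fun [set: measurableTypeR R] (fun x : R => ((x + t) ^+ 2)%:E).
  by apply/measurable_EFinP/measurable_funX/measurable_funD.
have ge0S (t x : R) : (0 <= ((x + t) ^+ 2)%:E)%E by rewrite lee_fin sqr_ge0.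
have sym : (\int[N01]_x ((x - s) ^+ 2)%:E = \int[N01]_x ((x + s) ^+ 2)%:E)%E.
  rewrite -(ge0_integral_std_normalN (mS s))//; apply: eq_integral => x _.
  by congr EFin; ring.
have : (\int[N01]_x ((x - s) ^+ 2)%:E + \int[N01]_x ((x + s) ^+ 2)%:E =
    (2 * (1 + s ^+ 2))%:E)%E.
  rewrite -ge0_integralD//.
  transitivity (\int[N01]_x ((2 * x ^+ 2)%:E + (2 * s ^+ 2)%:E))%E.
    by apply: eq_integral => x _; rewrite -!EFinD; congr EFin; ring.
  rewrite ge0_integralD//=.
  - rewrite integral_cst//= probability_setT mule1.
    under eq_integral do rewrite EFinM.
    rewrite ge0_integralZl//= ?integral_sqr_std_normal.
    + by rewrite mule1 -EFinD; congr EFin; ring.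
    + by apply/measurable_EFinP/measurable_funX.
    + by move=> x _; rewrite lee_fin sqr_ge0.
  - by move=> x _; rewrite lee_fin mulr_ge0// sqr_ge0.
  - by apply/measurable_EFinP/measurable_funM => //; exact: measurable_funX.
  - by move=> x _; rewrite lee_fin mulr_ge0// sqr_ge0.
have : (0 <= \int[N01]_x ((x + s) ^+ 2)%:E)%E by exact: integral_ge0.
rewrite {}sym; case: (\int[N01]_x _)%E => [a||]//= _ [h]; congr EFin; lra.
Qed.

End normal.

(** * The standard Gaussian vector *)

Section std_gaussian.
Variable R : realType.
Local Notation N01 := (normal_prob (0 : R) 1).

Definition box n (B : 'I_n -> set R) : set (n.-tuple R) :=
  [set t | forall i, B i (tnth t i)].

Lemma measurable_box n (B : 'I_n -> set R) :
  (forall i, measurable (B i)) -> measurable (box B).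
Proof.
move=> mB; rewrite [X in measurable X](_ : _ = \bigcap_(i in [set: 'I_n])
    ((fun t : n.-tuple R => tnth t i) @^-1` B i)); last first.
  by apply/seteqP; split => t /= h i => [_|]; exact: h.
apply: fin_bigcap_measurable => // i _; rewrite -[X in measurable X]setTI.
exact: measurable_tnth.
Qed.

(** The boxes are stable under intersection and generate the sigma-algebra. *)
Lemma std_gaussian_unique n (P : probability (n.-tuple R) R) :
  (forall B : 'I_n -> set R, (forall i, measurable (B i)) ->
     P (box B) = (\prod_(i < n) N01 (B i))%E) ->
  forall A, measurable A -> P A = std_gaussian R n A.
Proof.
move=> PB A mA.
pose G := [set A : set (n.-tuple R) |
  exists2 B : 'I_n -> set R, (forall i, measurable (B i)) & A = box B].
apply: (@g_sigma_algebra_measure_unique _ R _ G _ (fun=> setT)).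
- by move=> _ [B mB ->]; exact: measurable_box.
- by move=> _; exists (fun=> setT) => //; apply/seteqP; split.
- by rewrite bigcup_const.
- move=> _ _ [B mB ->] [B' mB' ->]; exists (fun i => B i `&` B' i).
    by move=> i; exact: measurableI.
  apply/seteqP; split=> t.
    by move=> [h h'] i; split; [exact: h | exact: h'].
  by move=> h; split=> i; have [] := h i.
- move=> _ [B mB ->]; exact: (etrans (PB _ mB) (esym (std_gaussian_box mB))).
- by move=> _; rewrite [ltLHS](@probability_setT _ _ _ P) ltry.
move: mA; apply: smallest_sub; first exact: smallest_sigma_algebra.
rewrite -bigcup_seq => _ [i _ [B mB <-]]; apply: sub_sigma_algebra.
exists (fun j => if j == i then B else setT).
  by move=> j; case: ifP.
rewrite setTI; apply/seteqP; split=> t /=.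
  by move=> Bt j; case: eqP => // ->.
by move=> /(_ i); rewrite eqxx.
Qed.

Definition pick_coords n d (s : 'I_d -> 'I_n) (t : n.-tuple R) : d.-tuple R :=
  [tuple tnth t (s i) | i < d].

Lemma measurable_pick_coords n d (s : 'I_d -> 'I_n) :
  measurable_fun setT (pick_coords s).
Proof.
apply/measurable_fun_tnthP => i.
rewrite (_ : _ \o _ = fun t : n.-tuple R => tnth t (s i)); last first.
  by apply/funext => t /=; rewrite tnth_mktuple.
exact: measurable_tnth.
Qed.

(** Distinct coordinates of a standard Gaussian vector, taken in any order, form
    a standard Gaussian vector.  This contains both the invariance under
    rotations and the law of a block of coordinates. *)
Lemma std_gaussian_pick_coords n d (s : 'I_d -> 'I_n) (A : set (d.-tuple R)) :
  injective s -> measurable A ->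
  pushforward (std_gaussian R n) (pick_coords s) A = std_gaussian R d A.
Proof.
move=> sI mA.
have ms := measurable_pick_coords s.
pose sm : {mfun _ >-> _} := HB.pack (pick_coords s) (isMeasurableFun.Build _ _ _ _ _ ms).
apply: (@std_gaussian_unique d (distribution (std_gaussian R n) sm)) mA => B mB.
rewrite /distribution/= /pushforward.
(* The preimage of a box is the box with no constraint on the coordinates that
   are not picked. *)
pose B' (j : 'I_n) := if [pick i | s i == j] is Some i then B i else setT.
have B's i : B' (s i) = B i.
  by rewrite /B'; case: pickP => [k /eqP/sI ->//|/(_ i)]; rewrite eqxx.
transitivity (std_gaussian R n (box B')).
  congr (std_gaussian R n _).
  apply/seteqP; split=> t /= h.
    move=> j; rewrite /B'; case: pickP => [i /eqP <-|]//.
    by have := h i; rewrite tnth_mktuple.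
  by move=> i; rewrite tnth_mktuple -B's; exact: h.
rewrite std_gaussian_box; last by move=> j; rewrite /B'; case: pickP.
rewrite (bigID (mem (codom s)))/= [X in (_ * X)%E]big1 ?mule1; last first.
  move=> j js; rewrite /B'; case: pickP => [i /eqP sj|_]; last exact: probability_setT.
  by rewrite -sj codom_f in js.
rewrite -big_uniq/=; last by rewrite map_inj_uniq ?enum_uniq.
by rewrite /codom /image_mem big_map big_enum; apply: eq_bigr => i _; rewrite B's.
Qed.

Lemma integral_pick_coords n d (s : 'I_d -> 'I_n) (f : d.-tuple R -> \bar R) :
  injective s -> measurable_fun setT f -> (forall t, 0 <= f t)%E ->
  (\int[std_gaussian R n]_t f (pick_coords s t) = \int[std_gaussian R d]_t f t)%E.
Proof.
move=> sI mf f0; have ms := measurable_pick_coords s.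
transitivity (\int[pushforward (std_gaussian R n) (pick_coords s)]_t f t)%E.
  by rewrite (ge0_integral_pushforward ms _ measurableT mf) ?preimage_setT.
by apply: eq_measure_integral => A mA _; exact: std_gaussian_pick_coords.
Qed.

Definition coord_sum n (t : n.-tuple R) : R := \sum_(i < n) tnth t i.

Lemma measurable_coord_sum n : measurable_fun setT (@coord_sum n).
Proof. by apply: measurable_sum => i; exact: measurable_tnth. Qed.

Lemma integral_sqr_coord_sum n :
  (\int[std_gaussian R n]_t (coord_sum t ^+ 2)%:E = n%:R%:E)%E.
Proof.
have m2 k : measurable_fun setT (fun t : k.-tuple R => (coord_sum t ^+ 2)%:E).
  by apply/measurable_EFinP/measurable_funX; exact: measurable_coord_sum.
have ge k (t : k.-tuple R) : (0 <= (coord_sum t ^+ 2)%:E)%E by rewrite lee_fin sqr_ge0.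
elim: n => [|n IHn].
  rewrite (eq_integral (fun=> 0%E)) ?integral0// => t _.
  by rewrite /coord_sum big_ord0 expr0n.
rewrite [LHS](ge0_integral_pushforward (@measurable_tuple_cons R n) _ measurableT (m2 _))//.
rewrite preimage_setT.
transitivity (\int[N01 \x std_gaussian R n]_z ((z.1 + coord_sum z.2) ^+ 2)%:E)%E.
  apply: eq_integral => -[x t] _ /=; congr (_ ^+ 2)%:E.
  rewrite /coord_sum big_ord_recl; congr (_ + _).
  by apply: eq_bigr => i _; exact: tnthS.
have mz : measurable_fun setT (fun z : measurableTypeR R * n.-tuple R =>
    ((z.1 + coord_sum z.2) ^+ 2)%:E).
  apply/measurable_EFinP/measurable_funX/measurable_funD => //.
  by apply: measurableT_comp => //; exact: measurable_coord_sum.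
(* Integrating the first coordinate first adds 1. *)
rewrite fubini_tonelli2//; last by move=> z; rewrite lee_fin sqr_ge0.
transitivity (\int[std_gaussian R n]_t (1 + (coord_sum t ^+ 2)%:E))%E.
  by apply: eq_integral => t _; rewrite -EFinD -integral_sqr_std_normalD.
rewrite ge0_integralD//; last exact: m2.
rewrite IHn integral_cst//= probability_setT mule1.
by rewrite -EFinD -natr1 addrC.
Qed.

Definition coords n (t : n.-tuple R) : nat -> R := nth 0 t.

Local Notation Q d := (proj_sqnorm (@nondecr R d) d).

(** Rounding all entries down to multiples of 1 / N preserves monotonicity. *)
Lemma gain_rat_approx d (x q : nat -> R) (e : R) : nondecr d q -> 0 < e ->
  exists2 u : d.-tuple rat, nondecr d (fun i => ratr (nth 0 u i) : R) &
    gain d x q - e <= gain d x (fun i => ratr (nth 0 u i)).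
Proof.
move=> qmon e0.
(* The gain varies by at most K / N when the entries of q
   decrease by at most 1 / N <= 1. *)
pose K : R := \sum_(i < d) (2 * `|x i| + 2 * `|q i| + 1).
have K0 : 0 <= K by apply: sumr_ge0 => i _; rewrite !addr_ge0 ?mulr_ge0.
pose N := (Num.bound (K / e)).+1.
have N0 : 0 < N%:R :> R by rewrite ltr0n.
have KN : K / N%:R <= e.
  rewrite ler_pdivrMr// mulrC -ler_pdivrMr//.
  have /archi_boundP/ltW : 0 <= K / e by rewrite divr_ge0// ltW.
  by move=> /le_trans; apply; rewrite ler_nat.
pose u := [tuple ((Num.floor (N%:R * q i))%:~R / N%:R : rat) | i < d].
have uE i : (i < d)%N -> ratr (nth 0 u i) = (Num.floor (N%:R * q i))%:~R / N%:R :> R.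
  move=> id; rewrite -(tnth_nth 0 u (Ordinal id)) tnth_mktuple/=.
  by rewrite fmorph_div/= ratr_int ratr_nat.
exists u.
  move=> i j ij jd; rewrite !uE//; last exact: leq_ltn_trans jd.
  by rewrite ler_pM2r ?invr_gt0// ler_int le_floor// ler_pM2l// qmon.
rewrite lerBlDr -lerBlDl -sumrB; apply: le_trans KN.
rewrite /K mulr_suml; apply: ler_sum => i _.
rewrite uE//; set v := _ / _.
have h1 : v <= q i.
  by rewrite ler_pdivrMr// mulrC floor_le.
have h2 : q i - v <= N%:R^-1.
  rewrite lerBlDr -[X in X + _]mul1r -mulrDl ler_pdivlMr// mulrC addrC -intrD1 ltW//.
  exact: floorD1_gt.
have N1 : N%:R^-1 <= 1 :> R by rewrite invf_le1// ler1n.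
have Ni : 0 < N%:R^-1 :> R by rewrite invr_gt0.
apply: (@le_trans _ _ ((2 * `|x i| + 2 * `|q i| + 1) * (q i - v))); last first.
  by rewrite ler_wpM2l// !addr_ge0 ?mulr_ge0.
have := ler_norm (x i); have := ler_norm (- q i); rewrite normrN => a b.
nra.
Qed.

(** The supremum over the monotone cone is the supremum over its countably many
    rational points, hence a countable supremum of measurable functions. *)
Lemma measurable_proj_sqnorm d : measurable_fun setT (fun t : d.-tuple R => Q d (coords t)).
Proof.
(* An enumeration of the rational points of the cone; codes of other vectors
   stand for 0. *)
pose r k : nat -> R :=
  if unpickle k is Some u then
    let q := fun i => ratr (nth 0 (u : d.-tuple rat) i) in
    if `[< nondecr d q >] then q else fun=> 0
  else fun=> 0.
have rmon k : nondecr d (r k).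
  rewrite /r; case: unpickle => [u|]; last exact: nondecr0.
  by case: asboolP => // _; exact: nondecr0.
pose h k (t : d.-tuple R) := gain d (coords t) (r k).
have hub t : has_ubound (range (h ^~ t)).
  by exists (Q d (coords t)) => _ [k _ <-]; exact: proj_sqnorm_ub.
rewrite (_ : (fun t => _) = (fun t => sups (h ^~ t) 0)).
  apply: measurable_fun_sups => [t _|k]; first exact: hub.
  apply: measurable_sum => i; apply: measurable_funB => //.
  apply: measurable_funM => //; apply: measurable_funM => //.
  rewrite /coords; under eq_fun do rewrite -tnth_nth.
  exact: measurable_tnth.
apply/funext => t; apply/eqP; rewrite eq_le; apply/andP; split.
  apply: proj_sqnorm_le => [|q qmon]; first by exists (fun=> 0); exact: nondecr0.
  apply/ler_addgt0Pr => e e0; rewrite -lerBlDr.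
  have [u umon] := gain_rat_approx (coords t) qmon e0.
  move=> /le_trans; apply; apply: ub_le_sup.
    by case: (hub t) => M MP; exists M => _ [k _ <-]; apply: MP; exists k.
  exists (pickle u) => //; rewrite /h /r pickleK.
  by case: asboolP.
apply: ge_sup; first by exists (h 0%N t), 0%N.
by move=> _ [k _ <-]; exact: proj_sqnorm_ub.
Qed.

End std_gaussian.

(** * The statistical dimension of a monotone cone *)

Section expected.
Variable R : realType.
Local Notation Q d := (proj_sqnorm (@nondecr R d) d).

Lemma measurable_proj_sqnorm_pick n d (e : nat -> nat) : (forall i, (i < d)%N -> (e i < n)%N) ->
  measurable_fun setT (fun t : n.-tuple R => Q d (fun i => coords t (e i))).
Proof.
move=> en; pose s (i : 'I_d) : 'I_n := Ordinal (en i (ltn_ord i)).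
rewrite (_ : (fun t => _) = (fun t : d.-tuple R => Q d (coords t)) \o pick_coords s).
  apply: measurableT_comp; [exact: measurable_proj_sqnorm|exact: measurable_pick_coords].
apply/funext => t /=; apply: eq_proj_sqnorm => i id.
by rewrite /coords -(tnth_nth _ _ (Ordinal id)) tnth_mktuple (tnth_nth 0).
Qed.

(** The expectation only depends on the number of entries that are read. *)
Lemma integral_proj_sqnorm_pick n d (e : nat -> nat) :
  (forall i, (i < d)%N -> (e i < n)%N) ->
  (forall i j, (i < d)%N -> (j < d)%N -> e i = e j -> i = j) ->
  (\int[std_gaussian R n]_t (Q d (fun i => coords t (e i)))%:E =
   \int[std_gaussian R d]_t (Q d (coords t))%:E)%E.
Proof.
move=> en einj; pose s (i : 'I_d) : 'I_n := Ordinal (en i (ltn_ord i)).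
have sI : injective s.
  by move=> i j /(congr1 val)/= /einj ij; apply/val_inj/ij.
rewrite -(integral_pick_coords sI).
- apply: eq_integral => t _; congr EFin; apply: eq_proj_sqnorm => i id.
  by rewrite /coords -(tnth_nth _ _ (Ordinal id)) tnth_mktuple (tnth_nth 0).
- by apply/measurable_EFinP; exact: measurable_proj_sqnorm.
- by move=> t; rewrite lee_fin proj_sqnorm_ge0//; exact: nondecr0.
Qed.

(** Integrating the cyclic identity: all rotations have the same law, and the
    square of the sum of the d + 1 entries has mean d + 1, so passing from
    dimension d to d + 1 adds 1 / (d + 1). *)
Lemma integral_proj_sqnorm_nondecr d :
  (\int[std_gaussian R d]_t (Q d (coords t))%:E = (harmonic_number R d)%:E)%E.
Proof.
have Q0 k (x : nat -> R) : (0 <= (Q k x)%:E)%E.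
  by rewrite lee_fin proj_sqnorm_ge0//; exact: nondecr0.
elim: d => [|d IHd].
  rewrite /harmonic_number big_geq// (eq_integral (fun=> 0%E)) ?integral0// => t _.
  congr EFin; apply/le_anti/andP; split; last by rewrite -lee_fin Q0.
  apply: proj_sqnorm_le => [|q _]; first by exists (fun=> 0); exact: nondecr0.
  by rewrite /gain big_ord0.
pose e r i := ((i + r) %% d.+1)%N.
have en r i : (e r i < d.+1)%N by rewrite ltn_mod.
have einj r i j : (i < d.+1)%N -> (j < d.+1)%N -> e r i = e r j -> i = j.
  move=> id jd /eqP; rewrite eqn_modDr => /eqP.
  by rewrite !modn_small.
have mE k r : (k <= d.+1)%N ->
    measurable_fun setT (fun t : d.+1.-tuple R => (Q k (rotate d.+1 r (coords t)))%:E).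
  by move=> kd; apply/measurable_EFinP; exact: (measurable_proj_sqnorm_pick (fun i _ => en r i)).
have rot k : (k <= d.+1)%N ->
    (\int[std_gaussian R d.+1]_t (\sum_(r < d.+1) (Q k (rotate d.+1 r (coords t)))%:E) =
    d.+1%:R%:E * \int[std_gaussian R k]_t (Q k (coords t))%:E)%E.
  move=> kd; rewrite ge0_integral_sum//; last by move=> r; exact: mE.
  under eq_bigr => r _ do rewrite (integral_proj_sqnorm_pick (fun i _ => en r i)
    (fun i j ik jk => einj r i j (leq_trans ik kd) (leq_trans jk kd))).
  by rewrite sumr_const card_ord mule_natl.
have : (d.+1%:R%:E * \int[std_gaussian R d.+1]_t (Q d.+1 (coords t))%:E =
    d.+1%:R%:E * (harmonic_number R d)%:E + 1)%E.
  rewrite -rot// -IHd -rot//.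
  transitivity (\int[std_gaussian R d.+1]_t
    (\sum_(r < d.+1) (Q d (rotate d.+1 r (coords t)))%:E +
     d.+1%:R^-1%:E * (coord_sum t ^+ 2)%:E))%E.
    apply: eq_integral => t _; rewrite !sumEFin sum_proj_sqnorm_rotate.
    rewrite EFinD; congr (_ + _)%E; rewrite mulrC EFinM; congr (_ * _)%E.
    by congr EFin; congr (_ ^+ 2); apply: eq_bigr => i _; rewrite (tnth_nth 0).
  have mS : measurable_fun setT (fun t : d.+1.-tuple R => (coord_sum t ^+ 2)%:E).
    by apply/measurable_EFinP/measurable_funX; exact: measurable_coord_sum.
  rewrite ge0_integralD//.
  - rewrite ge0_integralZl// ?integral_sqr_coord_sum -?EFinM ?mulVf ?pnatr_eq0//.
    by move=> t _; rewrite lee_fin sqr_ge0.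
  - by move=> t _; apply: sume_ge0.
  - by apply: emeasurable_sum => r; exact: mE.
  - by move=> t _; rewrite mule_ge0// lee_fin ?sqr_ge0.
  - by apply: measurable_funeM.
have : (0 <= \int[std_gaussian R d.+1]_t (Q d.+1 (coords t))%:E)%E by exact: integral_ge0.
have d0 : 0 < d.+1%:R :> R by rewrite ltr0n.
case: (integral _ _ _) => [a||]//.
  rewrite -!EFinM -EFinD => _ [h]; congr EFin.
  rewrite /harmonic_number big_nat_recr//= -/(harmonic_number R d).
  by apply: (mulfI (lt0r_neq0 d0)); rewrite h mulrDr divff ?lt0r_neq0.
by move=> _; rewrite gt0_muley ?lte_fin.
Qed.

End expected.

(** * Projection onto a closed cone *)

Section projection.
Variable R : realType.

Lemma continuous_entry n (i : 'I_n) : continuous (fun v : 'rV[R]_n => v 0 i).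
Proof. exact: coord_continuous. Qed.

(** Only the points at distance at most |x| from x compete with 0, and those
    form a compact part of C. *)
Lemma nearest_point_exists n (C : set 'rV[R]_n) (x : 'rV[R]_n) :
  closed C -> C 0 ->
  exists p, C p /\ forall q, C q -> eucl_norm (x - p) <= eucl_norm (x - q).
Proof.
move=> clC C0.
pose N (q : 'rV[R]_n) := \sum_i (x - q) 0 i ^+ 2.
have N0 q : 0 <= N q by apply: sumr_ge0 => i _; exact: sqr_ge0.
have cN : continuous N.
  apply: continuous_big => [|i _ q]; first exact: add_continuous.
  apply: (@continuous_comp _ _ _ (fun q : 'rV_n => (x - q) 0 i) (fun r => r ^+ 2)); last first.
    exact: exprn_continuous.
  rewrite (_ : (fun _ => _) = fun q : 'rV_n => x 0 i - q 0 i); last first.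
    by apply/funext => q'; rewrite !mxE.
  by apply: continuousB; [exact: cst_continuous | exact: continuous_entry].
pose B := C `&` [set q | N q <= N 0].
have clB : closed B.
  apply: closedI => //.
  rewrite (_ : [set q | _] = N @^-1` [set r | r <= N 0])//.
  by apply: closed_comp => //; exact: closed_le.
have cB : compact B.
  apply: (subclosed_compact clB (@rV_compact R^o n
    (fun i => `[x 0 i - (N 0 + 1), x 0 i + (N 0 + 1)]%classic) _)).
    by move=> i; exact: segment_compact.
  move=> q [_ /= Nq] i; rewrite /= in_itv/= -ler_distlC.
  have qN : (x 0 i - q 0 i) ^+ 2 <= N 0.
    apply: le_trans Nq; rewrite /N (bigD1 i)//= !mxE lerDl.
    by apply: sumr_ge0 => j _; exact: sqr_ge0.
  (* A crude bound: y^2 <= N 0 implies y <= N 0 + 1. *)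
  rewrite -real_normK ?num_real// in qN.
  have := N0 0; have := normr_ge0 (x 0 i - q 0 i); nra.
have [||p pB pmin] := @EVT_min_rV R n N B _ cB.
- by exists 0; split => /=.
- exact: continuous_subspaceT.
move: pB; rewrite inE => -[Cp Np]; exists p; split=> // q Cq.
rewrite ler_wsqrtr//; have [qN|/ltW qN] := leP (N q) (N 0).
  by apply: pmin; rewrite inE.
exact: le_trans qN.
Qed.

Lemma sqr_eucl_norm n (x : 'rV[R]_n) : eucl_norm x ^+ 2 = \sum_i x 0 i ^+ 2.
Proof. by rewrite sqr_sqrtr//; apply: sumr_ge0 => i _; exact: sqr_ge0. Qed.

(** The nearest point p maximizes the gain.  Along the ray of p the gain is
    2 a b - a^2 c with b = <x, p> and c = |p|^2; being largest at a = 1, it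
    forces b = c. *)
Lemma sqr_eucl_norm_proj n (C : set 'rV[R]_n) (t : n.-tuple R) :
  closed C -> C 0 -> (forall a q, 0 <= a -> C q -> C (a *: q)) ->
  eucl_norm (eucl_proj C (row_of_tuple t)) ^+ 2 =
  proj_sqnorm [set q : nat -> R | C (\row_i q i)] n (coords t).
Proof.
move=> clC C0 coneC; set x := row_of_tuple t.
have [Cp pmin] := xgetPex 0 (nearest_point_exists x clC C0).
rewrite -/(eucl_proj C x) in Cp pmin *; set p := eucl_proj C x in Cp pmin *.
pose ext (q : 'rV[R]_n) := coords [tuple q 0 i | i < n].
have extE q (i : 'I_n) : ext q i = q 0 i.
  by rewrite /ext /coords -tnth_nth tnth_mktuple.
have extK q : \row_i ext q i = q by apply/rowP => i; rewrite mxE extE.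
have xE (i : 'I_n) : x 0 i = coords t i by rewrite mxE (tnth_nth 0).
have gainE (q : nat -> R) : gain n (coords t) q =
    eucl_norm x ^+ 2 - eucl_norm (x - \row_i q i) ^+ 2.
  rewrite !sqr_eucl_norm -sumrB; apply: eq_bigr => i _.
  by rewrite !mxE (tnth_nth 0) -/(coords t i); ring.
have pmax (q : nat -> R) : C (\row_i q i) -> gain n (coords t) q <= gain n (coords t) (ext p).
  move=> Cq; rewrite !gainE extK lerD2l lerN2.
  by rewrite ler_sqr ?nnegrE ?sqrtr_ge0// pmin.
have -> : proj_sqnorm [set q : nat -> R | C (\row_i q i)] n (coords t) = gain n (coords t) (ext p).
  apply/le_anti/andP; split.
    by apply: proj_sqnorm_le => //; exists (ext p); rewrite /= extK.
  by apply: proj_sqnorm_ub; rewrite /= extK.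
pose b := \sum_(i < n) x 0 i * p 0 i; pose c := \sum_(i < n) p 0 i ^+ 2.
have gainZ a : gain n (coords t) (ext (a *: p)) = 2 * a * b - a ^+ 2 * c.
  rewrite /gain sumrB; congr (_ - _); rewrite mulr_sumr; apply: eq_bigr => i _.
    by rewrite extE mxE xE; ring.
  by rewrite extE mxE exprMn.
have le a : 0 <= a -> 2 * a * b - a ^+ 2 * c <= 2 * b - c.
  move=> a0; have := pmax (ext (a *: p)); rewrite extK gainZ.
  by rewrite -[X in ext X]scale1r gainZ; move/(_ (coneC _ _ a0 Cp)); lra.
rewrite -[X in ext X]scale1r gainZ sqr_eucl_norm -/c.
have c0 : 0 <= c by apply: sumr_ge0 => i _; exact: sqr_ge0.
(* a = 2 and a = 0 settle the case c = 0, and a = b / c the case c > 0. *)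
have h0 := le 0 (lexx 0); have h2 := le 2 (ler0n _ _).
suff : b = c by lra.
move: c0; rewrite le_eqVlt => /predU1P[c0|c0]; first by move: h0 h2; rewrite -c0; lra.
have b0 : 0 <= b by lra.
have /le : 0 <= b / c by rewrite divr_ge0// ltW.
rewrite (_ : _ - _ = b ^+ 2 / c); last by field; exact: lt0r_neq0.
rewrite ler_pdivrMr// => h.
have : (b - c) ^+ 2 <= 0 by lra.
by move=> bc; apply/eqP; rewrite -subr_eq0 -sqrf_eq0 eq_le bc sqr_ge0.
Qed.

End projection.

(** * Cutting a cone of monotone blocks *)

Section cuts.
Variable R : realType.
Local Notation Q d := (proj_sqnorm (@nondecr R d) d).
Implicit Types (L : pred nat) (x q : nat -> R).

(** L marks the positions where a new block begins. *)
Definition nondecr_off_cuts L d : set (nat -> R) :=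
  [set q | forall a, (a.+1 < d)%N -> ~~ L a.+1 -> q a <= q a.+1].

Lemma nondecr_off_cuts0 L d : nondecr_off_cuts L d (fun=> 0).
Proof. by move=> a _ _; exact: lexx. Qed.

Lemma gain_cat c d x q :
  gain (c + d) x q = gain c x q + gain d (fun i => x (c + i)%N) (fun i => q (c + i)%N).
Proof. by rewrite /gain big_split_ord. Qed.

(** At a cut the cone is a product, and the gain is a sum. *)
Lemma proj_sqnorm_cut L c d x : L c ->
  proj_sqnorm (nondecr_off_cuts L (c + d)) (c + d) x =
  proj_sqnorm (nondecr_off_cuts L c) c x +
  proj_sqnorm (nondecr_off_cuts (fun a => L (c + a)%N) d) d (fun i => x (c + i)%N).
Proof.
move=> Lc; apply/le_anti/andP; split.
  apply: proj_sqnorm_le => [|q qL]; first by exists (fun=> 0); exact: nondecr_off_cuts0.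
  rewrite gain_cat; apply: lerD; apply: proj_sqnorm_ub => a ad aL.
    by apply: qL => //; rewrite ltn_addr.
  by rewrite addnS; apply: qL; rewrite -addnS// ltn_add2l.
apply: proj_sqnorm_add => [||q1 q2 q1L q2L];
  try by exists (fun=> 0); exact: nondecr_off_cuts0.
pose q i := if (i < c)%N then q1 i else q2 (i - c)%N.
exists q.
  move=> a ad aL; rewrite /q; case: (ltnP a.+1 c) => ac.
    by rewrite (ltnW ac); apply: q1L.
  move: ac; rewrite leq_eqVlt => /predU1P[ac|ca]; first by rewrite -ac Lc in aL.
  rewrite ltnNge -ltnS ca/= subSn//; apply: q2L; first by rewrite -subSn// ltn_subLR// ltnW.
  by rewrite -subSn// subnKC// ltnW.
rewrite gain_cat le_eqVlt; apply/orP; left; apply/eqP.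
congr (_ + _); apply: eq_gain => // i id; first by rewrite /q id.
by rewrite /q ltnNge leq_addr addKn.
Qed.

Lemma proj_sqnorm_no_cut L d x : (forall a, (0 < a < d)%N -> ~~ L a) ->
  proj_sqnorm (nondecr_off_cuts L d) d x = Q d x.
Proof.
move=> noL; congr (proj_sqnorm _ d x); apply/seteqP; split=> q /= qmon; last first.
  by move=> a ad _; exact: qmon.
move=> i j ij; rewrite -(subnKC ij); elim: (j - i)%N => [|k IHk] kd.
  by rewrite addn0.
rewrite addnS in kd *; apply: le_trans (IHk (ltnW kd)) _.
by apply: qmon => //; apply: noL.
Qed.

Lemma proj_sqnorm_cuts L (c : nat -> nat) m x : c 0%N = 0%N ->
  (forall j, (j < m)%N -> (c j <= c j.+1)%N) ->
  (forall j, (j < m)%N -> L (c j)) ->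
  (forall j a, (j < m)%N -> (c j < a < c j.+1)%N -> ~~ L a) ->
  proj_sqnorm (nondecr_off_cuts L (c m)) (c m) x =
  \sum_(j < m) Q (c j.+1 - c j)%N (fun i => x (c j + i)%N).
Proof.
move=> c0; elim: m => [|m IHm] cS Lc noL.
  rewrite big_ord0 c0 proj_sqnorm_no_cut; last by case.
  apply/le_anti/andP; split; last by rewrite proj_sqnorm_ge0//; exact: nondecr0.
  apply: proj_sqnorm_le => [|q _]; first by exists (fun=> 0); exact: nondecr0.
  by rewrite /gain big_ord0.
rewrite big_ord_recr/= -IHm; first last.
- by move=> j a jm; apply: noL; exact: ltnW.
- by move=> j jm; apply: Lc; exact: ltnW.
- by move=> j jm; apply: cS; exact: ltnW.
rewrite -{1 2}(subnKC (cS m (ltnSn m))) proj_sqnorm_cut; last exact: Lc.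
congr (_ + _); apply: proj_sqnorm_no_cut => a /andP[a0 ad].
by apply: (noL m) => //; rewrite -addn1 leq_add2l a0/= -ltn_subRL.
Qed.

Lemma proj_sqnorm_rotate C C' n s x : (s <= n)%N -> C !=set0 ->
  (forall q, C q -> C' (rotate n s q)) -> (forall q, C' q -> C (rotate n (n - s) q)) ->
  proj_sqnorm C n x = proj_sqnorm C' n (rotate n s x).
Proof.
move=> sn [q0 Cq0] CC' C'C.
have gain_rot y q : gain n (rotate n s y) (rotate n s q) = gain n y q.
  exact: (sum_rotate n s (fun i => 2 * y i * q i - q i ^+ 2)).
apply/le_anti/andP; split.
  apply: proj_sqnorm_le => [|q Cq]; first by exists q0.
  by rewrite -gain_rot; apply: proj_sqnorm_ub; exact: CC'.
apply: proj_sqnorm_le => [|q C'q]; first by exists (rotate n s q0); exact: CC'.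
have -> : gain n (rotate n s x) q = gain n x (rotate n (n - s) q).
  rewrite -[RHS]gain_rot; apply: eq_gain => // i id; rewrite /rotate.
  by rewrite modnDml -addnA subnKC// modnDr modn_small.
by apply: proj_sqnorm_ub; exact: C'C.
Qed.

End cuts.

(** * The descent cone *)

Section cone.
Variables (R : realType) (n : nat).
Implicit Types (x y : 'rV[R]_n.+1).

Lemma monotone_signalP x : reflect
  (forall i j : 'I_n.+1, j = i.+1 :> nat -> x 0 i <= x 0 j) (monotone_signal x).
Proof.
apply: (iffP forallP) => [h i j ij|h i].
  by have /forallP/(_ j)/implyP := h i; apply; exact/eqP.
by apply/forallP => j; apply/implyP => /eqP; exact: h.
Qed.

Lemma jumpsP x (j : 'I_n.+1) : reflect
  (exists2 i : 'I_n.+1, j = i.+1 :> nat & x 0 i < x 0 j) (j \in jumps x).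
Proof.
rewrite inE; apply: (iffP existsP) => [[i /andP[/eqP ? ?]]|[i ji ?]]; exists i => //.
by apply/andP; split => //; exact/eqP.
Qed.

(** Where x is constant a descent direction must be nondecreasing, and where x
    jumps a short step cannot break monotonicity.  The condition that the
    variation does not increase links the last entry to the first one, so the
    entries are linked cyclically, ordS being the cyclic successor. *)
Lemma descent_cone_monotone_variation x : monotone_signal x ->
  descent_cone (@monotone_variation R n) x =
  [set y : 'rV[R]_n.+1 | forall i, ordS i \notin jumps x -> y 0 i <= y 0 (ordS i)].
Proof.
move=> xmon; have xm := monotone_signalP x xmon.
apply/seteqP; split=> y /=.
  move=> [tau /= tau0]; rewrite /monotone_variation xmon.
  case: ifPn => [ymon|_]; last by rewrite leye_eq.
  rewrite lee_fin !mxE => yend i.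
  case: (ltnP i n) => [ilt|ige].
    have ni : ordS i = i.+1 :> nat by rewrite /= modn_small// ltnS.
    move=> /jumpsP nj; have := monotone_signalP _ ymon i _ ni; rewrite !mxE.
    have : x 0 (ordS i) <= x 0 i.
      by rewrite leNgt; apply/negP => ?; apply: nj; exists i.
    by move=> ? ?; rewrite -(ler_pM2l tau0); lra.
  have i_n : i = ord_max by apply/val_inj/eqP; rewrite /= eqn_leq ige andbT -ltnS ltn_ord.
  have -> : ordS i = ord0.
    by apply/val_inj; rewrite i_n /= modnn.
  by move=> _; rewrite i_n -(ler_pM2l tau0); lra.
move=> ylink.
(* A step at most F (i, j) keeps the entries i and j in order. *)
pose F (p : 'I_n.+1 * 'I_n.+1) : R :=
  if x 0 p.1 < x 0 p.2 then (x 0 p.2 - x 0 p.1) / (1 + `|y 0 p.1| + `|y 0 p.2|) else 1.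
pose tau := \big[Num.min/1]_p F p.
have den p : 0 < 1 + `|y 0 p.1| + `|y 0 p.2| :> R.
  by rewrite -addrA ltr_pwDl// addr_ge0.
have tau0 : 0 < tau.
  apply: lt_bigmin => [|p _]; rewrite ?ltr01// /F; case: ifP => // lt.
  by rewrite divr_gt0// subr_gt0.
have tauF p : tau <= F p by exact: bigmin_le.
exists tau => //=; rewrite /monotone_variation xmon.
have -> : monotone_signal (x + tau *: y).
  apply/monotone_signalP => i j ij; rewrite !mxE.
  have nij : ordS i = j by apply/val_inj; rewrite /= -ij modn_small.
  have [/jumpsP[i' ji' lt]|] := boolP (j \in jumps x); last first.
    rewrite -nij => /ylink yij; rewrite lerD// ?xm//; first by rewrite nij.
    by rewrite ler_pM2l.
  have ii' : i' = i by apply/val_inj/eqP; rewrite -eqSS /= -ji' ij.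
  move: lt; rewrite ii' => lt.
  have := tauF (i, j); rewrite /F/= lt ler_pdivlMr; last exact: (den (i, j)).
  have := ler_norm (y 0 i); have := ler_norm (- y 0 j); rewrite normrN.
  nra.
rewrite lee_fin !mxE.
have nmax : ordS (ord_max : 'I_n.+1) = ord0.
  by apply/val_inj; rewrite /= modnn.
have := ylink ord_max; rewrite nmax.
have /[swap]/[apply] : ord0 \notin jumps x by apply/jumpsP => -[].
move=> yle; have : tau * y 0 ord_max <= tau * y 0 ord0 by rewrite ler_pM2l.
lra.
Qed.

End cone.

Section descent.
Variables (R : realType) (n : nat).

Lemma modnSml m d : ((m %% d).+1 %% d)%N = (m.+1 %% d)%N.
Proof. by rewrite -addn1 modnDml addn1. Qed.

(** Reading the entries from a jump s on makes the cyclic link from n to 0 an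
    ordinary one and breaks the cycle at s, so that the cone becomes a product
    of monotone blocks. *)
Lemma sqr_norm_proj_descent_cone (x0 : 'rV[R]_n.+1) (s : 'I_n.+1) (t : n.+1.-tuple R) :
  monotone_signal x0 -> s \in jumps x0 ->
  eucl_norm (eucl_proj (descent_cone (@monotone_variation R n) x0) (row_of_tuple t)) ^+ 2
  = proj_sqnorm (nondecr_off_cuts (fun a => inord ((a + s) %% n.+1)%N \in jumps x0) n.+1)
      n.+1 (rotate n.+1 s (coords t)).
Proof.
move=> x0mon sj; rewrite descent_cone_monotone_variation//.
set C := (X in eucl_proj X).
have sn : (s <= n.+1)%N by exact: ltnW.
rewrite sqr_eucl_norm_proj.
- apply: proj_sqnorm_rotate => //.
  + by exists (fun=> 0) => i _; rewrite !mxE.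
  + move=> q qC a an; pose i : 'I_n.+1 := inord ((a + s) %% n.+1)%N.
    have iE : i = ((a + s) %% n.+1)%N :> nat by rewrite inordK ?ltn_mod.
    have nE : ordS i = inord ((a.+1 + s) %% n.+1)%N.
      by apply/val_inj; rewrite /= inordK ?ltn_mod// iE modnSml addSn.
    by rewrite -nE => /qC; rewrite !mxE nE iE inordK ?ltn_mod.
  + move=> q qC i nj; rewrite !mxE; pose a := ((i + (n.+1 - s)) %% n.+1)%N.
    have as_i : ((a + s) %% n.+1)%N = i.
      by rewrite modnDml -addnA subnK// modnDr modn_small.
    have nE : inord ((a.+1 + s) %% n.+1)%N = ordS i.
      by apply/val_inj; rewrite /= inordK ?ltn_mod// -[in RHS]as_i modnSml addSn.
    have aS : ((ordS i + (n.+1 - s)) %% n.+1)%N = (a.+1 %% n.+1)%N.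
      by rewrite /= modnDml addSn modnSml.
    have an : (a < n.+1)%N by rewrite ltn_mod.
    rewrite /rotate aS -/a; move: an; rewrite leq_eqVlt => /predU1P[aN|an].
      by rewrite -nE aN modnDl modn_small// inord_val sj in nj.
    by rewrite modn_small//; apply: qC => //; rewrite nE.
- rewrite /C (_ : [set y | _] = \bigcap_(i in [set i | ordS i \notin jumps x0])
    [set y : 'rV[R]_n.+1 | 0 <= y 0 (ordS i) - y 0 i]); last first.
    by apply/seteqP; split=> y h i /=; [rewrite subr_ge0; exact: h
      | move=> /h /=; rewrite subr_ge0].
  apply: closed_bigI => i _.
  rewrite (_ : [set y | _] = (fun y : 'rV[R]_n.+1 => y 0 (ordS i) - y 0 i)
    @^-1` [set r | 0 <= r])//.
  apply: closed_comp => [y _|]; last exact: closed_ge.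
  by apply: continuousB; exact: continuous_entry.
- by move=> i _; rewrite !mxE.
- by move=> a q a0 qC i nj; rewrite !mxE ler_wpM2l// qC.
Qed.

End descent.

(* N is n.+1, and 'I_n.+1 numbers the entries from 0: the paper's index p is
   the ordinal of value p - 1.  The right-hand side involves only differences
   of indices, so this shift does not affect it. *)
Theorem theorem3p3 (R : realType) (n : nat) (x0 : 'rV[R]_n.+1)
    (k : nat) (i : nat -> 'I_n.+1)
    (x0_monotone : monotone_signal x0)
    (jumps_neq0 : jumps x0 != finset.set0)
    (i_increasing : forall a b : nat,
       (1 <= a)%N -> (a < b)%N -> (b <= k)%N -> (i a < i b)%N)
    (i_enum : forall m : 'I_n.+1,
       m \in jumps x0 <-> exists2 j : nat, (1 <= j <= k)%N & i j = m) :
  stat_dim (descent_cone (@monotone_variation R n) x0) =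
  (\sum_(2 <= j < k.+1) harmonic_number R (i j - i j.-1)
   + harmonic_number R (n.+1 + i 1%N - i k))%:E.
Proof.
have k0 : (0 < k)%N.
  have /set0Pn[m /i_enum[j /andP[j1 jk] _]] := jumps_neq0.
  exact: leq_trans jk.
have i_le a b : (1 <= a)%N -> (a <= b)%N -> (b <= k)%N -> (i a <= i b)%N.
  move=> a1; rewrite leq_eqVlt => /predU1P[->//|ab] bk.
  by apply/ltnW/i_increasing.
have i_lt a b : (1 <= b)%N -> (a <= k)%N -> (i a < i b)%N -> (a < b)%N.
  by move=> b1 ak; apply: contraTT; rewrite -!leqNgt => ba; exact: i_le.
have i_jump j : (1 <= j <= k)%N -> i j \in jumps x0.
  by move=> jk; apply/i_enum; exists j.
(* After rotation by the first jump the blocks begin at the positions c j; the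
   last block runs through the end of the signal up to the first jump. *)
pose s := i 1%N; pose c j := if (j < k)%N then (i j.+1 - s)%N else n.+1.
have sj : s \in jumps x0 by rewrite i_jump// k0.
have cE j : (j < k)%N -> (c j + s)%N = i j.+1.
  by move=> jk; rewrite /c jk subnK// i_le.
have ck : c k = n.+1 by rewrite /c ltnn.
have cS j : (j < k)%N -> (c j < c j.+1 <= n.+1)%N.
  move=> jk; have [jk'|jk'] := ltnP j.+1 k.
    have := cE j jk; have := cE j.+1 jk'; have := i_increasing j.+1 j.+2 isT (ltnSn _) jk'.
    have := ltn_ord (i j.+2); move: (c j) (c j.+1) => u v; lia.
  have -> : c j.+1 = n.+1 by rewrite /c ltnNge jk'.
  rewrite leqnn andbT.
  by rewrite /c jk (leq_ltn_trans (leq_subr _ _)).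
pose e j a := ((c j + a + s) %% n.+1)%N.
have projE t :
    eucl_norm (eucl_proj (descent_cone (@monotone_variation R n) x0) (row_of_tuple t)) ^+ 2
    = \sum_(j < k) proj_sqnorm (@nondecr R (c j.+1 - c j)) (c j.+1 - c j)
        (fun a => coords t (e j a)).
  rewrite (sqr_norm_proj_descent_cone t x0_monotone sj); set L := fun a : nat => _.
  have := @proj_sqnorm_cuts R L c k (rotate n.+1 s (coords t)).
  rewrite ck => ->//; rewrite /L.
  - by rewrite /c k0 subnn.
  - by move=> j /cS /andP[/ltnW].
  - by move=> j jk; rewrite cE// modn_small// inord_val i_jump// jk.
  - move=> j a jk /andP[ja aj]; apply/negP => /i_enum[j' /andP[j'1 j'k] ij'].
    have /(congr1 val)/= := ij'; rewrite inordK ?ltn_mod// => {}ij'.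
    have acj := leq_trans aj (proj2 (andP (cS j jk))).
    (* A jump strictly inside a block lies between two consecutive ones, or
       before the first one if the index has wrapped around. *)
    have [asn|asn] := ltnP (a + s) n.+1.
      rewrite modn_small// in ij'.
      have /i_lt jj' : (i j.+1 < i j')%N by rewrite ij' -cE// ltn_add2r.
      have {}jj' := jj' j'1 jk.
      have j1k : (j.+1 < k)%N by exact: leq_trans j'k.
      have : (i j' < i j.+2)%N by rewrite ij' -(cE j.+1)// ltn_add2r.
      by move=> /(i_lt j' j.+2 isT j'k); rewrite ltnS leqNgt jj'.
    have : (i j' < s)%N.
      rewrite ij' -(subnK asn) modnDr modn_small; have := ltn_ord s; lia.
    by rewrite ltnNge i_le.
have Q0 d (x : nat -> R) : (0 <= (proj_sqnorm (@nondecr R d) d x)%:E)%E.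
  by rewrite lee_fin proj_sqnorm_ge0//; exact: nondecr0.
have en j a : (a < c j.+1 - c j)%N -> (e j a < n.+1)%N by rewrite ltn_mod.
transitivity (\sum_(j < k) (harmonic_number R (c j.+1 - c j))%:E)%E.
  rewrite /stat_dim unlock.
  under eq_integral do rewrite projE -sumEFin.
  rewrite ge0_integral_sum//; last first.
    by move=> j; apply/measurable_EFinP; exact: (measurable_proj_sqnorm_pick (@en j)).
  apply: eq_bigr => j _.
  rewrite (integral_proj_sqnorm_pick R (@en j)) ?integral_proj_sqnorm_nondecr//.
  move=> a b ad bd; have /andP[_ cn] := cS j (ltn_ord j).
  have small u : (u < c j.+1 - c j)%N -> (u < n.+1)%N.
    by move=> ud; apply: leq_trans ud _; apply: leq_trans cn; exact: leq_subr.
  move/eqP; rewrite /e eqn_modDr eqn_modDl => /eqP.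
  by rewrite !modn_small ?small.
rewrite sumEFin; congr EFin.
have kE := prednK k0.
rewrite !big_add1 big_mkord -[in LHS]kE big_ord_recr/=; congr (_ + _).
  apply: eq_bigr => j _; have jk : (j.+1 < k)%N by rewrite -ltn_predRL.
  by rewrite -(cE j (ltnW jk)) -(cE j.+1 jk) subnDr.
congr harmonic_number; rewrite kE ck.
have := cE k.-1; rewrite kE leqnn => /(_ isT) <-.
rewrite -/s; move: (c _) (ltn_ord s) => u; lia.
Qed.
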